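(* Let $(I_i,f_i)_{i=1}^{\infty}$ be an inverse sequence of compact intervals with continuous bonding maps $f_i\colon I_{i+1}\to I_i$, let $Y=\varprojlim(I_i,f_i)_{i=1}^{\infty}$, and let $\mathcal{U}$ be a non-principal ultrafilter on $\mathbb{N}$. Then the limit-ultrafilter order $\leq_{\mathcal{U}}^{(I_i,f_i)_{i=1}^{\infty}}$ on $Y$ is an ultrafilter order on the chainable continuum $Y$. That is, every limit-ultrafilter order on a chainable continuum is an ultrafilter order.
   Context: A continuum is a compact connected metrizable space; fix a metric generating its topology. A chain in $X$ is a finite sequence of open sets $d_1,\dots,d_k$ (its links) with $d_i\cap d_j\neq\varnothing\iff|i-j|\le 1$; its mesh is the maximum of the diameters of its links. $X$ is chainable if for every $\varepsilon>0$ it is covered by a chain of mesh less than $\varepsilon$. $\mathbb{N}=\{1,2,3,\dots\}$. Let $\mathcal{D}=\{D_n\}_{n\in\mathbb{N}}$ be a sequence of chains $D_n=\{d_{1,n},\dots,d_{k_n,n}\}$, each covering $X$, with $\mathrm{mesh}(D_n)\to 0$, and let $\mathcal{U}$ be a non-principal ultrafilter on $\mathbb{N}$. Write $x\leq_{D_n}y$ iff there exist $i\le j\le k_n$ with $x\in d_{i,n}$ and $y\in d_{j,n}$, and $x\leq_{\mathcal{U}}^{\mathcal{D}}y$ iff $\{n\in\mathbb{N}: x\leq_{D_n}y\}\in\mathcal{U}$. This is a linear order on $X$. An ultrafilter order on $X$ is any order of the form $\leq_{\mathcal{U}}^{\mathcal{D}}$ for some such $\mathcal{D}$ and $\mathcal{U}$.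 For the inverse limit $\varprojlim(I_i,f_i)_{i=1}^\infty=\{(x_i)_{i\ge1}\in\prod_i I_i: f_i(x_{i+1})=x_i \text{ for all } i\}$ of compact intervals and a non-principal ultrafilter $\mathcal{U}$ on $\mathbb{N}$, the limit-ultrafilter order is defined by $x\leq_{\mathcal{U}}^{(I_i,f_i)_{i=1}^{\infty}}y\iff\{i\in\mathbb{N}:x_i\le y_i\}\in\mathcal{U}$. *)

(* Defs.v *)
From mathcomp Require Import all_boot all_order all_algebra.
From mathcomp Require Import all_classical all_reals all_analysis.

Set Implicit Arguments.
Unset Strict Implicit.
Unset Printing Implicit Defensive.

Import Order.TTheory GRing.Theory Num.Theory.
Import numFieldNormedType.Exports.

Local Open Scope classical_set_scope.
Local Open Scope ring_scope.

(* The index set {1, 2, 3, ...} is represented by nat, index i standing for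
   i + 1. *)

(* The axioms are those of isMetric. The metric is kept unbundled because it
   ranges over all metrics generating a topology that is already given. *)
Record compatible_metric (R : realType) (X : topologicalType)
    (dist : X -> X -> R) : Prop := {
  cm_distxx : forall x, dist x x = 0;
  cm_positivity : forall x y, dist x y = 0 -> x = y;
  cm_sym : forall x y, dist x y = dist y x;
  cm_triangle : forall y x z, dist x z <= dist x y + dist y z;
  cm_nbhs : forall x (A : set X),
    nbhs x A <-> exists2 e, 0 < e & [set y | dist x y < e] `<=` A }.

Definition continuum (R : realType) (X : topologicalType) : Prop :=
  [/\ compact [set: X], connected [set: X] &
      exists dist : X -> X -> R, compatible_metric dist].

(* Taking i = j in chain_meet shows that every link is nonempty. *)
Record chain (X : topologicalType) := Chain {
  chain_size : nat;
  link :> 'I_chain_size -> set X;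
  chain_open : forall i, open (link i);
  chain_meet : forall i j : 'I_chain_size,
    (link i `&` link j !=set0) <-> (`|i%:Z - j%:Z| <= 1) }.

Definition chain_covers (X : topologicalType) (D : chain X) : Prop :=
  \bigcup_i D i = [set: X].

(* Valued in the extended reals, so that an unbounded set has diameter +oo. *)
Definition diameter (R : realType) (X : Type) (dist : X -> X -> R)
    (A : set X) : \bar R :=
  ereal_sup [set (dist p.1 p.2)%:E | p in A `*` A].

(* Links being nonempty, their diameters are >= 0 and 0 is a neutral base. *)
Definition mesh (R : realType) (X : topologicalType) (dist : X -> X -> R)
    (D : chain X) : \bar R :=
  \big[maxe/0%E]_(i < chain_size D) diameter dist (D i).

Definition chainable (R : realType) (X : topologicalType)
    (dist : X -> X -> R) : Prop :=
  forall e : R, 0 < e ->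
    exists2 D : chain X, chain_covers D & (mesh dist D < e%:E)%E.

Definition chain_le (X : topologicalType) (D : chain X) (x y : X) : Prop :=
  exists i j : 'I_(chain_size D), [/\ (i <= j)%N, D i x & D j y].

Definition nonprincipal (T : Type) (U : set_system T) : Prop :=
  forall t, U <> principal_filter t.

Definition ultrafilter_le (X : topologicalType) (D : nat -> chain X)
    (U : set_system nat) (x y : X) : Prop :=
  U [set n | chain_le (D n) x y].

Definition is_ultrafilter_order (R : realType) (X : topologicalType)
    (dist : X -> X -> R) (le : X -> X -> Prop) : Prop :=
  exists (D : nat -> chain X) (U : set_system nat),
    [/\ forall n, chain_covers (D n),
        mesh dist (D n) @[n --> \oo] --> 0%E,
        UltraFilter U,
        nonprincipal U &
        forall x y, le x y <-> ultrafilter_le D U x y].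

(* [a, b] as a topological space of its own, with the subspace topology. *)
Definition itv_space (R : realType) (a b : R) : topologicalType :=
  set_type (`[a, b]%classic : set R).

(* The inverse limit, with the subspace topology of the product topology. *)
Definition inverse_limit (T : nat -> topologicalType)
    (f : forall i, T i.+1 -> T i) : topologicalType :=
  set_type ([set x | forall i, f i (x i.+1) = x i] : set (prod_topology T)).

Definition limit_ultrafilter_le (R : realType) (a b : nat -> R)
    (f : forall i, itv_space (a i.+1) (b i.+1) -> itv_space (a i) (b i))
    (U : set_system nat) (x y : inverse_limit f) : Prop :=
  U [set i | set_val (set_val x i) <= set_val (set_val y i)].

(* Main.v *)
Require Import Defs.
From mathcomp Require Import all_boot all_order all_algebra.
From mathcomp Require Import all_classical all_reals all_analysis.
From mathcomp Require Import zify lra.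

Set Implicit Arguments.
Unset Strict Implicit.
Unset Printing Implicit Defensive.

Import Order.TTheory GRing.Theory Num.Theory.
Import numFieldNormedType.Exports.

Local Open Scope classical_set_scope.
Local Open Scope ring_scope.

(** Write $Y$ for the inverse limit and $\pi_n$ for its $n$-th coordinate. The
ultrafilter order is obtained from the given ultrafilter $U$ itself, together
with chains $D_n$ that are pulled back along $\pi_n$: cut the interval
$\pi_n(Y)$ into a chain of short overlapping intervals and take preimages.

The order. Two points with $\pi_n(x) \le \pi_n(y)$ always satisfy
$x \le_{D_n} y$. Conversely, if $x \le_{D_n} y$ but $\pi_n(y) < \pi_n(x)$,
then $x$ and $y$ lie in the same or in neighbouring links, so that they are
close. For fixed $x \ne y$ and large $n$ this is impossible, so the two sets of
indices to be compared agree from some index on, and a non-principal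
ultrafilter does not see the difference (nonprincipal_ge).

The mesh. The fibres of $\pi_n$ shrink as $n$ grows, because $\pi_n$ determines
all earlier coordinates; by compactness, so do the preimages of sufficiently
short intervals (coord_modulus). This is quantified by one explicit metric
limit_dist, the supremum over $i$ of $\min(|x_i - y_i|, 1/(i+1))$, and
transported to an arbitrary compatible metric by compactness once more
(limit_dist_uniform).

The links are nonempty and consecutive ones meet because $\pi_n(Y)$ is an
interval (coord_intermediate). This comes from the intermediate value theorem:
a value between $\pi_n(x)$ and $\pi_n(y)$ lifts to a value between
$\pi_{n+1}(x)$ and $\pi_{n+1}(y)$, and so on, which gives a thread.

That $Y$ is a continuum follows: it is compact as a closed subspace of a product
of compact intervals, limit_dist metrizes it, and a compact chainable space is
connected (chainable_connected), since the links of a chain of mesh below the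
distance between two complementary clopen sets cannot pass from one to the
other. *)

(** * Compatible metrics and compactness *)

Section CompatibleMetric.
Context (R : realType) (X : topologicalType) (dist : X -> X -> R).
Context (dist_cm : compatible_metric dist).

Lemma compatible_metric_ge0 x y : 0 <= dist x y.
Proof.
have := cm_triangle dist_cm y x x.
rewrite (cm_distxx dist_cm) (cm_sym dist_cm y x).
by rewrite -mulr2n pmulrn_lge0.
Qed.

Lemma compatible_metric_nbhs x e : 0 < e -> nbhs x [set y | dist x y < e].
Proof. by move=> e0; apply/(cm_nbhs dist_cm); exists e. Qed.

Lemma compatible_metric_continuous :
  continuous (fun p : X * X => dist p.1 p.2 : R^o).
Proof.
move=> [x y]; apply/cvgrPdist_lt => e e0 /=.
have e2 : 0 < e / 2 by lra.
exists ([set x' | dist x x' < e / 2], [set y' | dist y y' < e / 2]).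
  by split; exact: compatible_metric_nbhs.
move=> [x' y'] [/= xx' yy'].
have := cm_triangle dist_cm x' x y; have := cm_triangle dist_cm y' x' y.
have := cm_triangle dist_cm x x' y'; have := cm_triangle dist_cm y x y'.
rewrite (cm_sym dist_cm x' x) (cm_sym dist_cm y' y) ltr_norml; lra.
Qed.

End CompatibleMetric.

(** The image of a compact set is closed, so that 0, not being in it, has a
neighbourhood missing it. *)
Lemma compact_away_from_zero (R : realType) (Z : topologicalType)
    (K : set Z) (q : Z -> R^o) :
  compact K -> continuous q -> (forall z, K z -> 0 < q z) ->
  exists2 d, 0 < d & forall z, K z -> d <= q z.
Proof.
move=> cK cq q0.
have : closed (q @` K).
  apply: compact_closed; first exact: Rhausdorff.
  by apply: continuous_compact => //; exact: continuous_subspaceT.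
move=> /closed_openC/(_ (0 : R^o)) [].
  by move=> [z Kz qz0]; have := q0 z Kz; rewrite qz0 ltxx.
move=> d /= d0 dq; exists d => // z Kz; rewrite leNgt; apply/negP => qzd.
apply: (dq (q z)); last by exists z.
by rewrite /= /ball /= sub0r normrN gtr0_norm// q0.
Qed.

(** For [q] a compatible metric this is uniform continuity of the identity; for
[q] the distance between the images under a map, it says that sets with small
image are small as soon as the fibres are. *)
Lemma compact_dist_modulus (R : realType) (X : topologicalType)
    (dist : X -> X -> R) (q : X * X -> R^o) (e : R) :
  compact [set: X] -> compatible_metric dist ->
  continuous q -> (forall z, 0 <= q z) ->
  (forall x y, q (x, y) = 0 -> dist x y < e) ->
  exists2 d, 0 < d & forall x y, q (x, y) < d -> dist x y < e.
Proof.
move=> cX dcm cq q0 q0e.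
have cK : compact [set z : X * X | e <= dist z.1 z.2].
  apply: (subclosed_compact _ (compact_setX cX cX)) => //.
  apply: (@closed_comp _ R^o (fun z : X * X => dist z.1 z.2) [set t | e <= t]).
    by move=> z _; exact: compatible_metric_continuous.
  exact: closed_ge.
have [|d d0 dq] := compact_away_from_zero cK cq.
  move=> [x y] /= exy; rewrite lt_neqAle q0 andbT.
  by apply/eqP => /esym/q0e; rewrite ltNge exy.
exists d => // x y qd; rewrite ltNge; apply/negP => /(dq (x, y)).
by rewrite leNgt qd.
Qed.

(** * Mesh of a chain and connectedness *)

Section Mesh.
Context (R : realType) (X : topologicalType) (dist : X -> X -> R).

Lemma mesh_le (D : chain X) e :
  0 <= e -> (forall i x y, D i x -> D i y -> dist x y <= e) ->
  (mesh dist D <= e%:E)%E.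
Proof.
move=> e0 De; apply: bigmax_le => // i _.
apply: ge_ereal_sup => _ [[x y] [/= Dx Dy] <-].
by rewrite lee_fin; exact: De Dx Dy.
Qed.

Lemma mesh_ge0 (D : chain X) : (0 <= mesh dist D)%E.
Proof.
exact: bigmax_ge_id.
Qed.

Lemma dist_link_mesh (D : chain X) i x y :
  D i x -> D i y -> ((dist x y)%:E <= mesh dist D)%E.
Proof.
move=> Dx Dy; apply: (@le_trans _ _ (diameter dist (D i))).
  by apply: ereal_sup_ubound; exists (x, y).
exact: (@le_bigmax _ _ _ _ (fun i => diameter dist (D i))).
Qed.

End Mesh.

(** If [B] is clopen and neither empty nor everything, then by compactness [B]
and its complement are at positive distance; a link of smaller diameter stays
on one side, and so does the whole chain, since neighbouring links meet. *)
Lemma chainable_connected (R : realType) (X : topologicalType)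
    (dist : X -> X -> R) :
  compact [set: X] -> compatible_metric dist -> chainable dist ->
  connected [set: X].
Proof.
move=> cX dcm dch B [x Bx] [C oC BC] [C' cC' BC'].
rewrite setTI in BC; rewrite setTI in BC'.
have oB : open B by rewrite BC.
have cB : closed B by rewrite BC'.
rewrite eqEsubset; split=> // y _; apply: contrapT => nBy.
have cK : compact (B `*` ~` B).
  apply: compact_setX; apply: (subclosed_compact _ cX) => //.
  exact: open_closedC.
have [|d d0 Bd] := compact_away_from_zero cK (compatible_metric_continuous dcm).
  move=> [u v] [/= Bu nBv]; rewrite lt_neqAle compatible_metric_ge0// andbT.
  by apply/eqP => /esym/(cm_positivity dcm) uv; apply: nBv; rewrite -uv.
have [D covD meshD] := dch _ d0.
have sameside i u v : D i u -> D i v -> B u -> B v.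
  move=> Du Dv Bu; apply: contrapT => nBv.
  have := le_lt_trans (dist_link_mesh dist Du Dv) meshD.
  by rewrite lte_fin ltNge (Bd (u, v)).
have step (i j : 'I_(chain_size D)) : `|i%:Z - j%:Z| <= 1 ->
    D i `<=` B -> D j `<=` B.
  move=> /(proj2 (chain_meet i j)) [w [wi wj]] DiB v Dv.
  exact: (sameside j w v wj Dv (DiB w wi)).
have [i _ Dix] : (\bigcup_i D i) x by rewrite covD.
have [j _ Djy] : (\bigcup_i D i) y by rewrite covD.
have DiB : D i `<=` B by move=> v Dv; exact: sameside Dix Dv Bx.
suff all k (kD : (k < chain_size D)%N) : D (Ordinal kD) `<=` B.
  by apply: nBy; case: j Djy => j jD Djy; exact: (all j jD).
have up n (h : (i + n < chain_size D)%N) : D (Ordinal h) `<=` B.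
  elim: n h => [|n IH] h.
    by rewrite (_ : Ordinal h = i)//; apply: val_inj; rewrite /= addn0.
  have h' : (i + n < chain_size D)%N by rewrite (leq_trans _ h)// addnS.
  by apply: step (IH h'); rewrite /=; lia.
have down n (h : (i - n < chain_size D)%N) : D (Ordinal h) `<=` B.
  elim: n h => [|n IH] h.
    by rewrite (_ : Ordinal h = i)//; apply: val_inj; rewrite /= subn0.
  have h' : (i - n < chain_size D)%N by rewrite (leq_ltn_trans (leq_subr _ _)).
  by apply: step (IH h'); rewrite /=; lia.
have [ik|ki] := leqP i k.
  have h : (i + (k - i) < chain_size D)%N by rewrite subnKC.
  by rewrite (_ : Ordinal kD = Ordinal h)//; apply: val_inj; rewrite /= subnKC.
have h : (i - (i - k) < chain_size D)%N by rewrite subKn// ltnW.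
rewrite (_ : Ordinal kD = Ordinal h)//.
by apply: val_inj; rewrite /= subKn// ltnW.
Qed.

(** * Chains of preimages of intervals *)

(** With [c] the infimum of the image, the links are the preimages of the
intervals from [c + k - 1] to [c + k + 1]. Only those [k] for which [c + k] does
not exceed the supremum are kept, so that every overlap of consecutive intervals
lies inside the image.

The conclusion holds the covering property and the smallness of the links: take
[x] equal to [y], or [x] and [y] in a common link. *)
Lemma unit_grid_chain (R : realType) (X : topologicalType) (g : X -> R^o)
    (A B : R) :
  continuous g -> (forall x, A <= g x <= B) ->
  (forall x y t, g x <= t <= g y -> exists z, g z = t) ->
  exists D : chain X, forall x y,
    (g x <= g y -> chain_le D x y) /\ (chain_le D x y -> g x < g y + 2).
Proof.
move=> cg gAB gitv.
(* Links being nonempty, the empty space is covered by the chain of no links. *)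
have [[x0 _]|X0] := pselect ([set: X] !=set0); last first.
  have link0 (i : 'I_0) : False by case: i.
  exists (@Chain X 0 (fun=> set0) (fun i => False_ind _ (link0 i))
    (fun i => False_ind _ (link0 i))) => x.
  by exfalso; apply: X0; exists x.
have gi : has_inf (range g).
  split; first by exists (g x0), x0.
  by exists A => _ [x _ <-]; case/andP: (gAB x).
have gs : has_sup (range g).
  split; first by exists (g x0), x0.
  by exists B => _ [x _ <-]; case/andP: (gAB x).
set c := inf (range g); set s := sup (range g).
have cgx x : c <= g x by apply: ge_inf; [case: gi | exists x].
have gxs x : g x <= s by apply: sup_ubound; [case: gs | exists x].
have inside t : c < t -> t < s -> exists z, g z = t.
  move=> ct ts.
  have [|_ [x _ <-] xt] := inf_adherent (_ : 0 < t - c) gi; first lra.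
  have [|_ [y _ <-] ty] := sup_adherent (_ : 0 < s - t) gs; first lra.
  by apply: (gitv x y); rewrite -/c -/s in xt ty; lra.
have sc0 : 0 <= s - c by have := cgx x0; have := gxs x0; lra.
pose K := Num.truncn (s - c).
have /andP[Ks sK] := truncn_itv sc0; rewrite -/K -natr1 in Ks sK.
pose link (k : 'I_K.+1) :=
  g @^-1` [set t | c + (k%:R - 1) < t < c + (k%:R + 1)].
have olink k : open (link k).
  apply: open_comp; first by move=> ? _; exact: cg.
  rewrite (_ : [set _ | _] = `]c + (k%:R - 1), c + (k%:R + 1)[%classic).
    exact: itv_open.
  by apply/seteqP; split=> t /=; rewrite in_itv.
have linkE k x :
    link k x = (c + (k%:R - 1) < g x < c + (k%:R + 1)) :> Prop by [].
have meet_next k (k1 : (k < K.+1)%N) (k2 : (k.+1 < K.+1)%N) :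
    link (Ordinal k1) `&` link (Ordinal k2) !=set0.
  have kK : (k.+1)%:R <= K%:R :> R by rewrite ler_nat.
  rewrite -natr1 in kK; have k0 : 0 <= k%:R :> R by [].
  have [||z gz] := inside (c + (k%:R + 2^-1)); [lra|lra|].
  exists z; split; rewrite linkE /= gz -?[k.+1%:R]natr1; apply/andP;
    by split; lra.
have meet_self k (k1 : (k < K.+1)%N) : link (Ordinal k1) !=set0.
  case: k k1 => [|k] k1; last first.
    by have [z []] := meet_next k (ltnW k1) k1; exists z.
  have [|_ [x _ <-] xc] := inf_adherent (_ : 0 < 1) gi; first lra.
  by exists x; rewrite linkE /=; have := cgx x; rewrite -/c in xc; lra.
have meetP (i j : 'I_K.+1) : link i `&` link j !=set0 <-> `|i%:Z - j%:Z| <= 1.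
  split.
    move=> [x [ix jx]]; rewrite linkE in ix; rewrite linkE in jx.
    have ij : (i%:R < (j + 2)%:R :> R) by rewrite natrD; lra.
    have ji : (j%:R < (i + 2)%:R :> R) by rewrite natrD; lra.
    by move: ij ji; rewrite !ltr_nat; lia.
  case: i j => [i iK] [j jK] /= ij.
  have [ij1|[ij1|ij1]] : j = i \/ j = i.+1 \/ i = j.+1 by lia.
  - subst j; have [z zi] := meet_self i iK.
    by exists z; split=> //; rewrite (bool_irrelevance jK iK).
  - by subst j; exact: meet_next.
  - by subst i; rewrite setIC; exact: meet_next.
(* A point [z] is placed in the link whose index is the integral part of
   [g z - c]; this choice is monotone in [g z]. *)
exists (@Chain X K.+1 link olink meetP) => x y; split=> [gxy|].
  have tr z : (Num.truncn (g z - c) < K.+1)%N.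
    by rewrite ltnS; apply: le_truncn; have := gxs z; lra.
  have ltr z : link (Ordinal (tr z)) z.
    have gz : 0 <= g z - c by have := cgx z; lra.
    by rewrite linkE /=; have := truncn_itv gz; rewrite -natr1; lra.
  exists (Ordinal (tr x)), (Ordinal (tr y)); split=> //=.
  by apply: le_truncn; lra.
move=> [i [j [ij ix jy]]]; rewrite /= !linkE in ix jy.
have : i%:R <= j%:R :> R by rewrite ler_nat.
by lra.
Qed.

Lemma grid_chain (R : realType) (X : topologicalType) (g : X -> R^o)
    (A B e : R) :
  continuous g -> (forall x, A <= g x <= B) ->
  (forall x y t, g x <= t <= g y -> exists z, g z = t) -> 0 < e ->
  exists D : chain X, forall x y,
    (g x <= g y -> chain_le D x y) /\ (chain_le D x y -> g x < g y + e).
Proof.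
move=> cg gAB gitv e0; have e2 : 0 < e / 2 by lra.
have [||x y t|D HD] := @unit_grid_chain R X (fun x => g x / (e / 2))
  (A / (e / 2)) (B / (e / 2)).
- by move=> x; apply: cvgMl; exact: cg.
- by move=> x; rewrite !ler_pM2r ?invr_gt0.
- rewrite ler_pdivrMr// ler_pdivlMr// => /gitv[z gz].
  by exists z; rewrite gz mulfK// gt_eqF.
exists D => x y; have [le_ch ch_lt] := HD x y; split=> [gxy|/ch_lt].
  by apply: le_ch; rewrite ler_pM2r ?invr_gt0.
by rewrite ltr_pdivrMr// mulrDl divfK ?gt_eqF// mulrC divfK.
Qed.

(** * Initial topologies, products and intervals *)

Lemma cvg_initialP (S : choiceType) (T : topologicalType) (g : S -> T)
    (F : set_system S) (s : initial_topology g) (FF : Filter F) :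
  F --> s <-> g @ F --> g s.
Proof.
split=> [Fs|gFs].
  by apply: cvg_trans (cvg_app g Fs) _; exact: initial_continuous.
move=> A [_ [[B oB <-] Bs sBA]]; apply: filterS sBA _.
by apply: gFs; exact: open_nbhs_nbhs.
Qed.

Lemma cvg_prod_topologyP (I : eqType) (T : I -> topologicalType)
    (F : set_system (prod_topology T)) (x : prod_topology T) (FF : Filter F) :
  F --> x <-> forall i, (fun y : prod_topology T => y i) @ F --> x i.
Proof.
pose ev i (y : prod_topology T) := y i; rewrite cvg_sup; split=> H i.
  exact: (proj1 (@cvg_initialP _ _ (ev i) F x FF) (H i)).
exact: (proj2 (@cvg_initialP _ _ (ev i) F x FF) (H i)).
Qed.

Lemma cvg_setvalP (T : topologicalType) (A : set T) (F : set_system A)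
    (x : A) (FF : Filter F) :
  F --> x <-> set_val @ F --> (set_val x : T).
Proof. exact: cvg_initialP. Qed.

Lemma compact_set_type (T : topologicalType) (A : set T) :
  compact A -> compact [set: A].
Proof.
move=> cA F PF _.
have FA : (set_val @ F) A by apply: (@filterE _ F) => x; exact: (set_valP x).
have [p [Ap Fp]] := cA (set_val @ F) _ FA.
exists (SigSub (mem_set Ap)); split=> // B C FB [_ [[C' oC' <-] C'p sC]].
have FB' : (set_val @ F) (set_val @` B).
  by apply: (@filterS _ F _ B) FB => x Bx; exists x.
have C'p' : nbhs p C' by apply: open_nbhs_nbhs; split.
by have [_ [[x Bx <-] C'x]] := Fp _ _ FB' C'p'; exists x; split=> //; exact: sC.
Qed.

Section Interval.
Context (R : realType) (a b : R).

Lemma itv_space_bounds (x : itv_space a b) : a <= set_val x <= b.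
Proof. by have := set_valP x; rewrite /= in_itv. Qed.

Lemma itv_space_val_continuous :
  continuous (fun x : itv_space a b => set_val x : R^o).
Proof. exact: initial_continuous. Qed.

Lemma itv_space_compact : compact [set: itv_space a b].
Proof. by apply: compact_set_type; exact: segment_compact. Qed.

Context (hab : a <= b).

Lemma clamp_subproof t : `[a, b]%classic (Num.max a (Num.min t b)).
Proof. by rewrite /= in_itv /= le_max lexx/= ge_max hab ge_min lexx orbT. Qed.

(** The retraction of the line onto [[a, b]], through which maps between the
spaces [itv_space] become functions on the line. *)
Definition clamp (t : R) : itv_space a b := SigSub (mem_set (clamp_subproof t)).

Lemma clampE t : a <= t <= b -> set_val (clamp t) = t.
Proof. by move=> /andP[at_ tb]; rewrite set_valE /= min_l// max_r. Qed.

Lemma clampK (x : itv_space a b) : clamp (set_val x) = x.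
Proof. by apply: val_inj; apply: clampE; exact: itv_space_bounds. Qed.

Lemma clamp_continuous : continuous (clamp : R^o -> itv_space a b).
Proof.
move=> t.
apply: (proj2 (@cvg_setvalP R^o `[a, b]%classic
  (clamp @ t) (clamp t) (fmap_filter _ _))).
have := @continuous_max R R^o (fun=> a) (id \min (fun=> b)) t.
apply; first exact: cst_continuous.
by apply: continuous_min; [exact: cvg_id|exact: cst_continuous].
Qed.

End Interval.

(** The preimage is found between [p] and [q], so that the lemma can be applied
again to lift it through the next map. *)
Lemma itv_space_IVT (R : realType) (a b c d : R)
    (f : itv_space a b -> itv_space c d) (p q : itv_space a b)
    (v : itv_space c d) :
  continuous f ->
  Num.min (set_val (f p)) (set_val (f q)) <= set_val v
    <= Num.max (set_val (f p)) (set_val (f q)) ->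
  exists w, f w = v /\
    Num.min (set_val p) (set_val q) <= set_val w
      <= Num.max (set_val p) (set_val q).
Proof.
move=> cf; wlog pq : p q / set_val p <= set_val q.
  move=> IVTle; have [/IVTle//|qp] := orP (le_total (set_val p) (set_val q)).
  rewrite (minC (set_val (f p))) (maxC (set_val (f p))) => /(IVTle _ _ qp).
  by rewrite (minC (set_val q)) (maxC (set_val q)).
have hab : a <= b by have /andP[ap /(le_trans ap)] := itv_space_bounds p.
pose g t := set_val (f (clamp hab t)).
have cg : continuous (g : R^o -> R^o).
  move=> t; apply: continuous_comp; last exact: itv_space_val_continuous.
  by apply: continuous_comp; [exact: clamp_continuous|exact: cf].
rewrite -[in X in X -> _](clampK hab p) -[in X in X -> _](clampK hab q).
move=> /(IVT pq (continuous_subspaceT cg)) [w]; rewrite in_itv /= => pwq gw.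
exists (clamp hab w); split; first exact: val_inj.
rewrite clampE ?(min_l pq) ?(max_r pq)//.
have /andP[ap _] := itv_space_bounds p; have /andP[_ qb] := itv_space_bounds q.
by case/andP: pwq => pw wq; rewrite (le_trans ap)// (le_trans wq).
Qed.

(** * Coordinates on the inverse limit *)

Definition coord (R : realType) (a b : nat -> R)
    (f : forall i, itv_space (a i.+1) (b i.+1) -> itv_space (a i) (b i))
    (i : nat) (x : inverse_limit f) : R := set_val (set_val x i).

Lemma cvg_inverse_limitP (R : realType) (a b : nat -> R)
    (f : forall i, itv_space (a i.+1) (b i.+1) -> itv_space (a i) (b i))
    (F : set_system (inverse_limit f)) (x : inverse_limit f) (FF : Filter F) :
  F --> x <-> forall i, coord i @ F --> coord i x.
Proof.
rewrite cvg_setvalP cvg_prod_topologyP; split=> H i.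
  exact: (proj1 (@cvg_setvalP R^o `[a i, b i]%classic _ _ _) (H i)).
exact: (proj2 (@cvg_setvalP R^o `[a i, b i]%classic _ _ _) (H i)).
Qed.

Lemma coord_continuous (R : realType) (a b : nat -> R)
    (f : forall i, itv_space (a i.+1) (b i.+1) -> itv_space (a i) (b i)) i :
  continuous (@coord R a b f i).
Proof. by move=> x; apply: (cvg_inverse_limitP x (nbhs_filter x)).1. Qed.

Section InverseLimit.
Context (R : realType) (a b : nat -> R).
Context (hab : forall i, a i <= b i).
Context (f : forall i, itv_space (a i.+1) (b i.+1) -> itv_space (a i) (b i)).
Context (hf : forall i, continuous (@f i)).

Lemma coord_bounds i (x : inverse_limit f) : a i <= coord i x <= b i.
Proof. exact: itv_space_bounds. Qed.

Lemma coord_inj (x y : inverse_limit f) :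
  (forall i, coord i x = coord i y) -> x = y.
Proof.
move=> xy; apply: val_inj; apply: functional_extensionality_dep => i.
by apply: val_inj; exact: xy.
Qed.

Lemma bond_coord (x : inverse_limit f) i :
  f (set_val x i.+1) = set_val x i.
Proof. exact: (set_valP x i). Qed.

Lemma coord_eq_le (x y : inverse_limit f) i n :
  (i <= n)%N -> coord n x = coord n y -> coord i x = coord i y.
Proof.
elim: n => [|n IH]; first by rewrite leqn0 => /eqP ->.
rewrite leq_eqVlt => /orP[/eqP ->//|/IH {}IH xy]; apply: IH.
rewrite /coord -(bond_coord x) -(bond_coord y).
by congr (set_val (f _)); exact: val_inj.
Qed.

Lemma inverse_limit_compact : compact [set: inverse_limit f].
Proof.
pose T i := itv_space (a i) (b i); pose P := prod_topology T.
apply: compact_set_type.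
have cP : compact [set: P].
  have := @tychonoff nat T (fun=> setT)
    (fun i => @itv_space_compact R (a i) (b i)).
  by congr compact; apply/seteqP; split.
apply: subclosed_compact cP _ => //.
pose ev i (x : P) : T i := x i.
have cev i : continuous (ev i) := @proj_continuous nat T i.
have -> : [set x : P | forall i, f (x i.+1) = x i] = \bigcap_i
    ((fun x => set_val (f (ev i.+1 x)) - set_val (ev i x) : R^o) @^-1` [set 0]).
  apply/seteqP; split=> [x fx i _|x fx i]; first by rewrite /= fx subrr.
  by apply: val_inj; apply/eqP; rewrite -subr_eq0; apply/eqP; exact: fx.
apply: closed_bigI => i _; apply: closed_comp; last exact: (@closed_eq R^o).
have cval j : continuous (fun y : T j => set_val y : R^o).
  exact: itv_space_val_continuous.
move=> x _; apply: (@cvgB R R^o P (nbhs x) (nbhs_filter x)).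
  apply: (@continuous_comp P (T i) R^o (@f i \o ev i.+1)); last exact: cval.
  by apply: (@continuous_comp P (T i.+1) (T i)); [exact: cev|exact: hf].
by apply: (@continuous_comp P (T i) R^o); [exact: cev|exact: cval].
Qed.

(** Only the equations below [n] are imposed: the coordinates above [n] are
those of the arbitrary point [p]. *)
Lemma exists_thread_below (p : forall i, itv_space (a i) (b i)) n
    (r : itv_space (a n) (b n)) :
  exists z : forall i, itv_space (a i) (b i),
    z n = r /\ forall i, (i < n)%N -> f (z i.+1) = z i.
Proof.
elim: n r => [|n IH] r; first by exists (dfwith p 0%N r); rewrite dfwithin.
have [z [zn fz]] := IH (f r).
exists (dfwith z n.+1 r); split=> [|i]; first by rewrite dfwithin.
rewrite ltnS leq_eqVlt => /orP[/eqP ->|ilt].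
  by rewrite dfwithin dfwithout ?zn// gtn_eqF.
by rewrite !dfwithout ?fz// gtn_eqF// ltnS// ltnW.
Qed.

(** Below [n] the thread consists of the images of [t]; from [n] on it is lifted
step by step, staying between [x] and [y], where the intermediate value theorem
provides the next lift. *)
Lemma coord_intermediate n (x y : inverse_limit f) t :
  coord n x <= t <= coord n y -> exists z : inverse_limit f, coord n z = t.
Proof.
move=> xty; pose r := clamp (hab n) t.
have rt : set_val r = t.
  apply: clampE; case/andP: xty => xt ty.
  have /andP[ax _] := coord_bounds n x; have /andP[_ yb] := coord_bounds n y.
  by rewrite (le_trans ax)// (le_trans ty).
have [p [pn fp]] := exists_thread_below (set_val x) r.
pose between i (w : itv_space (a i) (b i)) :=
  Num.min (coord i x) (coord i y) <= set_val w
    <= Num.max (coord i x) (coord i y).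
have liftable i (w : itv_space (a i) (b i)) :
    exists w', between i w -> f w' = w /\ between i.+1 w'.
  have [bw|nbw] := pselect (between i w); last by exists (set_val x i.+1).
  have [|w' w'P] := itv_space_IVT (p := set_val x i.+1)
    (q := set_val y i.+1) (v := w) (@hf i).
    by rewrite !bond_coord.
  by exists w'.
pose lift i := projT1 (choice (liftable i)).
have liftP i w : between i w -> f (lift i w) = w /\ between i.+1 (lift i w).
  exact: (projT2 (choice (liftable i))).
pose fix z i : itv_space (a i) (b i) :=
  if i is j.+1 then if (j < n)%N then p j.+1 else lift j (z j) else p 0%N.
have zp i : (i <= n)%N -> z i = p i by case: i => //= i ->.
have zb k : between (n + k)%N (z (n + k)%N).
  elim: k => [|k IH].
    rewrite addn0 zp// pn /between rt; case/andP: xty => xt ty.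
    by rewrite ge_min xt le_max ty orbT.
  by rewrite addnS /= ltnNge leq_addr /=; exact: (liftP _ _ IH).2.
have fz i : f (z i.+1) = z i.
  rewrite /=; case: ltnP => [ilt|]; first by rewrite fp// zp// ltnW.
  by move=> ni; apply: (liftP _ _ _).1; rewrite -(subnKC ni).
exists (SigSub (mem_set fz) : inverse_limit f).
by rewrite -rt -pn -(zp n (leqnn n)).
Qed.

(** * A metric on the inverse limit *)

(** The truncation makes the distances at the levels from [n] on small whatever
the points are, so that only finitely many levels matter at each scale. *)
Definition level_dist (i : nat) (x y : inverse_limit f) : R :=
  Num.min `|coord i x - coord i y| i.+1%:R^-1.

Definition limit_dist (x y : inverse_limit f) : R :=
  sup (range (fun i => level_dist i x y)).

Lemma level_dist_le_limit i x y : level_dist i x y <= limit_dist x y.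
Proof.
apply: ub_le_sup; last by exists i.
exists 1 => _ [j _ <-]; rewrite /level_dist ge_min; apply/orP; right.
by rewrite invf_le1 ?ler1n.
Qed.

Lemma limit_dist_le x y e :
  (forall i, level_dist i x y <= e) -> limit_dist x y <= e.
Proof.
move=> le_e; apply: ge_sup; first by exists (level_dist 0 x y), 0%N.
by move=> _ [i _ <-].
Qed.

(** Points with the same coordinate [n] agree at every level up to [n], and at
the later levels the truncation is at most the inverse of [n + 2]. *)
Lemma limit_dist_fibre n (x y : inverse_limit f) :
  coord n x = coord n y -> limit_dist x y < n.+1%:R^-1.
Proof.
move=> xy; apply: (@le_lt_trans _ _ n.+2%:R^-1); last first.
  by rewrite ltf_pV2 ?posrE// ltr_nat.
apply: limit_dist_le => i; rewrite /level_dist ge_min.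
have [ilen|nlti] := leqP i n.
  by rewrite (coord_eq_le ilen xy) subrr normr0 invr_ge0 ler0n.
by rewrite lef_pV2 ?posrE// ler_nat ltnS nlti orbT.
Qed.

Lemma near_limit_dist x e : 0 < e -> nbhs x [set y | limit_dist x y < e].
Proof.
move=> e0; have e2 : 0 < e / 2 by lra.
have [N _ small] := near_infty_natSinv_lt (PosNum e2).
have : \forall y \near x, forall i : 'I_N, `|coord i x - coord i y| < e / 2.
  apply: (@filter_forall _ _ _ _ (nbhs_filter x)) => i.
  by have /cvgrPdist_lt/(_ _ e2) := @coord_continuous R a b f i x.
apply: filterS => y xy; apply: (@le_lt_trans _ _ (e / 2)); last lra.
apply: limit_dist_le => i; rewrite /level_dist ge_min.
have [Ni|iN] := leqP N i; first by rewrite (ltW (small i Ni)) orbT.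
by rewrite ltW// (xy (Ordinal iN)).
Qed.

Lemma limit_dist_compatible : compatible_metric limit_dist.
Proof.
split.
- move=> x; apply/eqP; rewrite eq_le limit_dist_le => [/=|i]; last first.
    by rewrite /level_dist subrr normr0 ge_min lexx.
  rewrite (le_trans _ (level_dist_le_limit 0 x x))//.
  by rewrite /level_dist subrr normr0 le_min lexx invr_ge0 ler0n.
- move=> x y xy; apply: coord_inj => i.
  have := level_dist_le_limit i x y; rewrite xy /level_dist ge_min.
  by rewrite normr_le0 subr_eq0 leNgt invr_gt0 ltr0n orbF => /eqP.
- move=> x y.
  have xy : (fun i => level_dist i x y) = (fun i => level_dist i y x).
    by apply: funext => i; rewrite /level_dist distrC.
  by rewrite /limit_dist xy.
- move=> y x z; apply: limit_dist_le => i.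
  apply: le_trans (lerD (level_dist_le_limit i x y)
    (level_dist_le_limit i y z)).
  have truncated (p q r s : R) : 0 <= p -> 0 <= q -> 0 <= s -> r <= p + q ->
      Num.min r s <= Num.min p s + Num.min q s.
    move=> p0 q0 s0 rpq; rewrite ge_min.
    case: (leP p s) => ps; case: (leP q s) => qs; apply/orP;
      by [left; lra | right; lra].
  by apply: truncated; rewrite ?invr_ge0// ler_distD.
move=> x A; split=> [xA|[e e0 sA]]; last first.
  exact: (filterS sA (near_limit_dist x e0)).
(* That the balls form a base at [x] means that the filter they generate
   converges to [x], which can be tested on each coordinate. *)
pose F := filter_from [set e : R | 0 < e]
  (fun e => [set y | limit_dist x y < e]).
have FF : Filter F.
  apply: filter_from_filter; first by exists 1; exact: ltr01.
  move=> d e d0 e0; exists (Num.min d e); first by rewrite /= lt_min d0.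
  by move=> y; rewrite /= lt_min => /andP[].
suff : F --> x by move=> /(_ A xA).
apply/cvg_inverse_limitP => i; apply/cvgrPdist_lt => e e0.
exists (Num.min e i.+1%:R^-1); first by rewrite /= lt_min e0 invr_gt0 ltr0n.
move=> y /(le_lt_trans (level_dist_le_limit i x y)) /=.
rewrite /level_dist lt_min !gt_min ltxx orbF.
by move=> /andP[/orP[//|ie] xyi]; exact: lt_trans xyi ie.
Qed.

(** * Chains pulled back along a coordinate *)

(** The fibres of the coordinate [n] have diameter below the inverse of [n + 1];
by compactness the same holds for the preimages of short intervals. *)
Lemma coord_modulus n :
  exists2 d, 0 < d & forall x y : inverse_limit f,
    `|coord n x - coord n y| < d -> limit_dist x y < n.+1%:R^-1.
Proof.
apply: (compact_dist_modulus inverse_limit_compact limit_dist_compatible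
  (q := fun p => `|coord n p.1 - coord n p.2|)) => //.
  move=> p; apply: cvg_norm; apply: (@cvgB R R^o _ (nbhs p) (nbhs_filter p)).
    apply: (@continuous_comp _ _ R^o fst); first exact: cvg_fst.
    exact: coord_continuous.
  apply: (@continuous_comp _ _ R^o snd); first exact: cvg_snd.
  exact: coord_continuous.
move=> x y /= /eqP; rewrite normr_eq0 subr_eq0 => /eqP.
exact: limit_dist_fibre.
Qed.

(** The exceptional case is that of two points in the same link or in
neighbouring ones, whose order the chain does not see. *)
Lemma coord_chain n : exists D : chain (inverse_limit f), forall x y,
  (coord n x <= coord n y -> chain_le D x y) /\
  (chain_le D x y -> coord n x <= coord n y \/ limit_dist x y < n.+1%:R^-1).
Proof.
have [d d0 dP] := coord_modulus n.
have [D DP] := grid_chain (@coord_continuous R a b f n) (coord_bounds n)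
  (@coord_intermediate n) d0.
exists D => x y; split=> [|xy]; first exact: (DP x y).1.
have [|yx] := leP (coord n x) (coord n y); [by left|right].
by apply: dP; have := (DP x y).2 xy; rewrite gtr0_norm ?subr_gt0//; lra.
Qed.

Lemma limit_dist_uniform (dist : inverse_limit f -> inverse_limit f -> R) e :
  compatible_metric dist -> 0 < e -> exists N, forall n, (N <= n)%N ->
    forall x y, limit_dist x y < n.+1%:R^-1 -> dist x y < e.
Proof.
move=> dcm e0.
have [||x y /= /(cm_positivity limit_dist_compatible) ->|d d0 dP] :=
  compact_dist_modulus inverse_limit_compact dcm
  (q := fun p => limit_dist p.1 p.2) (e := e) _ _ _.
- exact: compatible_metric_continuous limit_dist_compatible.
- by move=> p; exact: compatible_metric_ge0 limit_dist_compatible _ _.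
- by rewrite (cm_distxx dcm).
have [N _ NP] := near_infty_natSinv_lt (PosNum d0).
by exists N => n Nn x y xy; apply: dP; exact: lt_trans xy (NP n Nn).
Qed.

End InverseLimit.

(** * The ultrafilter order *)

(** An ultrafilter that contains a singleton is principal, so that removing the
indices below [N] one at a time never leaves [U]. *)
Lemma nonprincipal_ge (U : set_system nat) N :
  UltraFilter U -> nonprincipal U -> U [set n | (N <= n)%N].
Proof.
move=> UU npU; have PU : ProperFilter U := ultra_proper.
elim: N => [|N IH]; first by apply: filterS filterT => n _ /=.
have UN : U (~` [set N]).
  have [UN|//] := in_ultra_setVsetC [set N] UU.
  have ultraN := principal_filter_ultra N; exfalso; apply: (npU N).
  apply: (@max_filter _ _ ultraN).
  by move=> A NA; apply: filterS UN => _ ->; exact: NA.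
apply: filterS (filterI IH UN) => n [/= Nn nN].
by rewrite ltn_neqAle Nn andbT eq_sym; apply/eqP.
Qed.

Theorem theorem3p8 (R : realType) (a b : nat -> R)
    (hab : forall i, a i <= b i)
    (f : forall i, itv_space (a i.+1) (b i.+1) -> itv_space (a i) (b i))
    (hf : forall i, continuous (f i))
    (U : set_system nat) (hU : UltraFilter U) (hUnp : nonprincipal U) :
  continuum R (inverse_limit f) /\
  forall dist : inverse_limit f -> inverse_limit f -> R,
    compatible_metric dist ->
    chainable dist /\
    is_ultrafilter_order dist (@limit_ultrafilter_le R a b f U).
Proof.
have [D DP] := choice (coord_chain hab hf).
have covD n : chain_covers (D n).
  apply/seteqP; split=> // x _.
  by have [i [j [_ Dx _]]] := (DP n x x).1 (lexx _); exists i.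
have linkD n i x y : D n i x -> D n i y -> limit_dist x y < n.+1%:R^-1.
  move=> ix iy; have le_xy : chain_le (D n) x y by exists i, i.
  have le_yx : chain_le (D n) y x by exists i, i.
  have [xy|//] := (DP n x y).2 le_xy.
  have [yx|] := (DP n y x).2 le_yx; last first.
    by rewrite (cm_sym (limit_dist_compatible f)).
  by apply: limit_dist_fibre; apply/eqP; rewrite eq_le xy.
have meshD (dist : inverse_limit f -> inverse_limit f -> R) e :
    compatible_metric dist -> 0 < e ->
    exists N, forall n, (N <= n)%N -> (mesh dist (D n) <= e%:E)%E.
  move=> dcm e0; have [N NP] := limit_dist_uniform hf dcm e0.
  exists N => n Nn; apply: mesh_le; first exact: ltW.
  by move=> i x y ix iy; apply/ltW/(NP n Nn); exact: linkD ix iy.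
have chD (dist : inverse_limit f -> inverse_limit f -> R) :
    compatible_metric dist -> chainable dist.
  move=> dcm e e0; have [|N NP] := meshD dist (e / 2) dcm; first lra.
  exists (D N) => //; apply: le_lt_trans (NP N (leqnn N)) _.
  by rewrite lte_fin; lra.
have cY := inverse_limit_compact hf.
have ldcm := limit_dist_compatible f.
split; first split=> //.
  exact: chainable_connected cY ldcm (chD _ ldcm).
  by exists (@limit_dist R a b f).
move=> dist dcm; split; first exact: chD.
exists D, U; split=> //.
  apply/fine_cvgP; split.
    have [N NP] := meshD dist 1 dcm ltr01; exists N => // n /= Nn.
    rewrite fin_numElt (lt_le_trans _ (mesh_ge0 _ _))//.
    by rewrite (le_lt_trans (NP n Nn)) ?ltry.
  apply/cvgrPdist_le => e e0; have [N NP] := meshD dist e dcm e0.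
  exists N => // n /= Nn; rewrite sub0r normrN.
  have mesh0 := mesh_ge0 dist (D n); rewrite ger0_norm ?fine_ge0//.
  rewrite -lee_fin fineK ?NP// fin_numElt (lt_le_trans _ mesh0)//.
  by rewrite (le_lt_trans (NP n Nn)) ?ltry.
move=> x y; have PU : ProperFilter U := ultra_proper; split=> [|xyD].
  by apply: filterS => n; exact: (DP n x y).1.
have [<-|xy] := pselect (x = y); first by apply: filterS filterT => n _ /=.
have dxy : 0 < dist x y.
  rewrite lt_neqAle compatible_metric_ge0// andbT.
  by apply/eqP => /esym/(cm_positivity dcm).
(* Beyond [N], two points that are close at scale [n] are at distance less than
   that of [x] and [y]; this excludes the exceptional case of coord_chain. *)
have [N NP] := limit_dist_uniform hf dcm dxy.
apply: filterS (filterI (nonprincipal_ge N hU hUnp) xyD) => n [/= Nn].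
by move=> /(DP n x y).2[//|/(NP n Nn)]; rewrite ltxx.
Qed.
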